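(* Let $\Omega \neq \emptyset$ and let $k: \Omega \times \Omega \to \mathbb{R}$ be a reproducing kernel on $\Omega$ with corresponding reproducing kernel Hilbert space $H$. Let $\mu$ be a $\sigma$-finite measure on $\Omega$ such that $H \subset L^2(\Omega,\mu)$, and let $S: H \to L^2(\Omega,\mu)$, $f \mapsto f$, be the identical embedding (which is continuous). Define the integral operators $T_{H,H}: H \to H$, $T_{H,L^2}: H \to L^2(\Omega,\mu)$ and $T_{L^2,L^2}: L^2(\Omega,\mu) \to L^2(\Omega,\mu)$, all given by the same formula $$f \mapsto \Big( s \mapsto \int_\Omega k(s,t) f(t)\, d\mu(t)\Big).$$ Then the following conditions are equivalent: (1) $S$ is compact; (2) each of the operators $T_{H,H}$, $T_{H,L^2}$, $T_{L^2,L^2}$ is compact (equivalently, at least one of them is compact); (3) for every sequence $(f_n)_{n\in\mathbb{N}} \subset H$ which is bounded in the norm of $H$ and converges pointwise on $\Omega$ to $0$, one has $$\lim_{n\to\infty} \int_\Omega \Big( \int_\Omega k(s,t) f_n(t)\, d\mu(t)\Big)^2 d\mu(s) = 0.$$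
   Context: A reproducing kernel Hilbert space $H$ on $\Omega$ with kernel $k$ is a Hilbert space of real-valued functions on $\Omega$ such that $k(s,\cdot)\in H$ for all $s\in\Omega$ and $f(s)=\langle f, k(s,\cdot)\rangle_H$ for all $f\in H$, $s\in\Omega$. The condition $H \subset L^2(\Omega,\mu)$ means every $f\in H$ is a representative of an element of $L^2(\Omega,\mu)$; the identical embedding $S$ is then assumed to be a continuous linear operator. *)

(* Defs.v *)
From HB Require Import structures.
From mathcomp Require Import all_boot all_order all_algebra.
From mathcomp Require Import all_classical all_reals all_analysis.
Set Implicit Arguments. Unset Strict Implicit. Unset Printing Implicit Defensive.
Import Order.TTheory GRing.Theory Num.Theory.
Import numFieldNormedType.Exports.
Local Open Scope classical_set_scope.
Local Open Scope ring_scope.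

Section Defs.
Context {R : realType}.

(** A (real) Hilbert space of real-valued functions on [T], given by its
    carrier [H : set (T -> R)] and inner product [ip] (only meaningful on H). *)
Definition Hnorm {T : Type} (ip : (T -> R) -> (T -> R) -> R) (f : T -> R) : R :=
  Num.sqrt (ip f f).

Definition is_function_Hilbert_space {T : Type} (H : set (T -> R))
    (ip : (T -> R) -> (T -> R) -> R) : Prop :=
  [/\
      [/\ H (fun _ => 0),
        (forall f g, H f -> H g -> H (f \+ g)) &
        (forall (a : R) f, H f -> H (fun x => a * f x))],
      [/\ (forall f g, H f -> H g -> ip f g = ip g f),
        (forall f g h, H f -> H g -> H h -> ip (f \+ g) h = ip f h + ip g h),
        (forall (a : R) f g, H f -> H g -> ip (fun x => a * f x) g = a * ip f g),
        (forall f, H f -> 0 <= ip f f) &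
        (forall f, H f -> ip f f = 0 -> f = (fun _ => 0))] &
      (forall u : nat -> T -> R, (forall n, H (u n)) ->
         (forall e : R, 0 < e -> exists N : nat, forall m n : nat,
            (N <= m)%N -> (N <= n)%N -> Hnorm ip (u m \- u n) < e) ->
         exists g, H g /\ (fun n => Hnorm ip (u n \- g)) @ \oo --> (0 : R))].

Definition is_RKHS {T : Type} (k : T -> T -> R) (H : set (T -> R))
    (ip : (T -> R) -> (T -> R) -> R) : Prop :=
  [/\ is_function_Hilbert_space H ip,
      (forall s, H (k s)) &
      (forall f s, H f -> f s = ip f (k s))].

(** Square integrable functions (representatives of elements of L^2(mu)). *)
Definition L2 {d} {T : measurableType d} (mu : {measure set T -> \bar R})
    (f : T -> R) : Prop :=
  measurable_fun setT f /\ ('N[mu]_(2%:E)[EFin \o f] < +oo)%E.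

(** L^2 norm (real valued; finite on L2 functions). *)
Definition L2norm {d} {T : measurableType d} (mu : {measure set T -> \bar R})
    (f : T -> R) : R := fine ('N[mu]_(2%:E)[EFin \o f]).

Definition int_op {d} {T : measurableType d} (mu : {measure set T -> \bar R})
    (k : T -> T -> R) (f : T -> R) : T -> R :=
  fun s => Rintegral mu setT (fun t => k s t * f t).

Definition compact_operator {T1 T2 : Type}
    (X : set (T1 -> R)) (nX : (T1 -> R) -> R)
    (Y : set (T2 -> R)) (nY : (T2 -> R) -> R)
    (A : (T1 -> R) -> (T2 -> R)) : Prop :=
  forall u : nat -> T1 -> R, (forall n, X (u n)) ->
    (exists M : R, forall n, nX (u n) <= M) ->
    exists phi : nat -> nat, (forall n, (phi n < phi n.+1)%N) /\
      exists g, Y g /\ (fun n => nY (A (u (phi n)) \- g)) @ \oo --> (0 : R).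

End Defs.

(* Main.v *)
Require Import Defs.
From HB Require Import structures.
From mathcomp Require Import all_boot all_order all_algebra.
From mathcomp Require Import all_classical all_reals all_analysis.
From mathcomp Require Import ring lra.
Set Implicit Arguments. Unset Strict Implicit. Unset Printing Implicit Defensive.
Import Order.TTheory GRing.Theory Num.Theory.
Import numFieldNormedType.Exports.
Local Open Scope classical_set_scope.
Local Open Scope ring_scope.

(** The adjoint of the embedding [S : H -> L2] is the integral operator: by the
    Riesz representation theorem [<f, g>_L2 = <f, h>_H] for some [h] in [H], and
    evaluating [h] against the kernel gives [h = int_op g].  So the three integral
    operators are [S* S], [S S* S] and [S S*], and the inequalities
    [|S f|^2 <= |f| |S* S f|] and [|S* S f|^2 <= |S S* S f| |S f|] bring the
    compactness of [S] back from that of any of them.  Condition (3) says that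
    [S S* S] maps weakly null sequences of [H] to norm null ones; weak
    compactness of bounded sequences, which is needed to use it, comes from weak
    limits along ultrafilters.  Replacing Cauchy limits in [L2] by such weak
    limits also makes the completeness of [L2] superfluous. *)

(** * Ultrafilters, sequences and subsequences *)

Section UltrafilterFacts.

(** Maximality passes to the image because [F] contains the preimage of each set or that of its
    complement. *)
Lemma ultra_fmap (S T : Type) (F : set_system S) (f : S -> T) :
  UltraFilter F -> UltraFilter (f @ F).
Proof.
move=> FU; split => [|G PG FG]; first exact: fmap_proper_filter.
rewrite eqEsubset; split => // A GA.
have [//|FnA] := in_ultra_setVsetC (f @^-1` A) FU.
exfalso; have /FG GnA : (f @ F) (~` A) by [].
have /filter_ex[x []] // : G (A `&` ~` A) by exact: filterI.
Qed.

Lemma bounded_ultra_cvg (R : realType) (S : Type) (F : set_system S)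
    (a : S -> R) (M : R) :
  UltraFilter F -> (forall n, `|a n| <= M) ->
  exists2 l, a @ F --> l & `|l| <= M.
Proof.
move=> FU aM; have := @segment_compact R (- M) M; rewrite compact_ultra.
move=> /(_ _ (ultra_fmap a FU))[|l [/= lM al]].
  by apply: nearW => n /=; rewrite in_itv/= -ler_norml.
by exists l => //; rewrite ler_norml; move: lM; rewrite in_itv.
Qed.

Lemma within_oo_proper (P : nat -> Prop) :
  (forall N, exists2 n, (N <= n)%N & P n) -> ProperFilter (within P \oo).
Proof.
move=> infP; split; last exact: within_filter.
by move=> [N _ Nh]; have [n /Nh] := infP N.
Qed.

(** If a neighbourhood [A] of [l] were missed infinitely often, [\oo] restricted to the missing
    indices would be proper, and an ultrafilter refining it would contain both the preimage of [A]
    and its complement. *)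
Lemma ultra_cvgP (R : realType) (a : nat -> R) (l : R) :
  (forall F, UltraFilter F -> \oo `<=` F -> a @ F --> l) -> a @ \oo --> l.
Proof.
move=> Fa A lA; apply: contrapT => nA.
have pG : ProperFilter (within (~` (a @^-1` A)) \oo).
  apply: within_oo_proper => N; apply: contrapT => h; apply: nA.
  exists N => // n /= Nn; apply: contrapT => nAn; apply: h.
  by exists n.
have [F [FU GF]] := ultraFilterLemma pG.
have FA : F (a @^-1` A).
  by apply: (Fa F) => // B [N _ NB]; apply: GF; exists N => // n /NB.
have FnA : F (~` (a @^-1` A)) by apply: GF; exists 0%N.
have /filter_ex[x []] // : F ((a @^-1` A) `&` ~` (a @^-1` A)) by exact: filterI.
Qed.

Lemma oo_ultra_gt (F : set_system nat) (N : nat) :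
  Filter F -> \oo `<=` F -> F [set n | (N < n)%N].
Proof. by move=> FF; apply; exists N.+1. Qed.

Lemma increasing_selection (P : nat -> nat -> Prop) :
  (forall j N, exists2 n, (N < n)%N & P j n) ->
  exists phi : nat -> nat,
    (forall n, (phi n < phi n.+1)%N) /\ forall n, P n (phi n).
Proof.
move=> h.
have /choice[s sP] (jN : nat * nat) : exists n, (jN.2 < n)%N /\ P jN.1 n.
  by have [n ? ?] := h jN.1 jN.2; exists n.
exists (fix phi n := if n is m.+1 then s (m.+1, phi m) else s (0%N, 0%N)).
split=> [n|[|n]]; [exact: (sP (_, _)).1|exact: (sP (_, _)).2..].
Qed.

Lemma increasing_geid (phi : nat -> nat) :
  (forall n, (phi n < phi n.+1)%N) -> forall n, (n <= phi n)%N.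
Proof.
by move=> h; elim=> // n IH; rewrite (leq_ltn_trans IH).
Qed.

Lemma cvg0_seqP (R : realType) (a : nat -> R) : (forall n, 0 <= a n) ->
  a @ \oo --> (0 : R) <->
  forall e, 0 < e -> exists N, forall n, (N <= n)%N -> a n < e.
Proof.
move=> a0; split=> [/cvgr0Pnorm_lt h e /h [N _ Nh]|h].
  by exists N => n /Nh /=; rewrite ger0_norm.
apply/cvgr0Pnorm_lt => e /h [N Nh]; exists N => // n /Nh /=.
by rewrite ger0_norm.
Qed.

End UltrafilterFacts.

(** * Semi-inner products, Cauchy-Schwarz and Riesz representation *)

Section SemiInnerProduct.
Context {R : realType} {T : Type}.

(** Semidefinite, so as to cover both the inner product of [H] and the L2 form on representatives,
    where [b f f = 0] for every [f] vanishing almost everywhere. *)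
Record semi_inner (X : set (T -> R)) (b : (T -> R) -> (T -> R) -> R) : Prop :=
  SemiInner {
  si0 : X 0;
  siD : forall f g, X f -> X g -> X (f + g);
  siZ : forall (a : R) f, X f -> X (a *: f);
  siC : forall f g, X f -> X g -> b f g = b g f;
  siDl : forall f g h, X f -> X g -> X h -> b (f + g) h = b f h + b g h;
  siZl : forall (a : R) f g, X f -> X g -> b (a *: f) g = a * b f g;
  si_ge0 : forall f, X f -> 0 <= b f f }.

Definition si_complete (X : set (T -> R)) (b : (T -> R) -> (T -> R) -> R) :=
  forall u : nat -> T -> R, (forall n, X (u n)) ->
    (forall e : R, 0 < e -> exists N : nat, forall m n : nat,
       (N <= m)%N -> (N <= n)%N -> Hnorm b (u m - u n) < e) ->
    exists g, X g /\ (fun n => Hnorm b (u n - g)) @ \oo --> (0 : R).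

Lemma quadratic_ge0_disc (p c q : R) : 0 <= q ->
  (forall t, 0 <= p + 2 * t * c + t ^+ 2 * q) -> c ^+ 2 <= p * q.
Proof.
move=> q0 h; have [q1|q1] := eqVneq q 0.
  have [c0|c0] := eqVneq c 0; first by rewrite c0 q1 expr0n mulr0.
  (* With [q = 0] the quadratic is affine of slope [2 * c]; at this point it equals -1. *)
  exfalso; have := h (- (p + 1) / (2 * c)).
  rewrite q1 mulr0 addr0 => hc.
  suff : p + 2 * (- (p + 1) / (2 * c)) * c = -1 by lra.
  by field.
have qp : 0 < q by rewrite lt_neqAle eq_sym q1.
(* The point [- c / q] is the minimizer of the quadratic. *)
have /(mulr_ge0 q0) := h (- c / q).
have -> : q * (p + 2 * (- c / q) * c + (- c / q) ^+ 2 * q) = p * q - c ^+ 2.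
  by field.
by rewrite subr_ge0.
Qed.

Context {X : set (T -> R)} {b : (T -> R) -> (T -> R) -> R} (siX : semi_inner X b).

Let X0 := si0 siX.
Let XD := siD siX.
Let XZ := siZ siX.

Lemma siN f : X f -> X (- f).
Proof. by move=> Xf; rewrite -scaleN1r; exact: XZ. Qed.

Lemma siB f g : X f -> X g -> X (f - g).
Proof. by move=> Xf Xg; apply: XD => //; exact: siN. Qed.

Lemma siNl f g : X f -> X g -> b (- f) g = - b f g.
Proof. by move=> Xf Xg; rewrite -scaleN1r (siZl siX)// mulN1r. Qed.

Lemma siBl f g h : X f -> X g -> X h -> b (f - g) h = b f h - b g h.
Proof. by move=> Xf Xg Xh; rewrite (siDl siX) ?siNl//; exact: siN. Qed.

Lemma siDr f g h : X f -> X g -> X h -> b h (f + g) = b h f + b h g.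
Proof.
move=> Xf Xg Xh; rewrite (siC siX)//; last exact: XD.
by rewrite (siDl siX)// !(siC siX (g := h)).
Qed.

Lemma siBr f g h : X f -> X g -> X h -> b h (f - g) = b h f - b h g.
Proof.
move=> Xf Xg Xh; rewrite (siC siX)//; last exact: siB.
by rewrite siBl// !(siC siX (g := h)).
Qed.

Lemma siZr a f g : X f -> X g -> b f (a *: g) = a * b f g.
Proof.
move=> Xf Xg; rewrite (siC siX)//; last exact: XZ.
by rewrite (siZl siX)// (siC siX Xg).
Qed.

Lemma Hnorm_ge0 f : 0 <= Hnorm b f.
Proof. exact: sqrtr_ge0. Qed.

Lemma Hnorm_sqr f : X f -> Hnorm b f ^+ 2 = b f f.
Proof. by move=> Xf; rewrite sqr_sqrtr// (si_ge0 siX). Qed.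

Lemma cauchy_schwarz_si f g : X f -> X g -> `|b f g| <= Hnorm b f * Hnorm b g.
Proof.
move=> Xf Xg; rewrite -(@ler_pXn2r _ 2)// ?nnegrE ?mulr_ge0 ?Hnorm_ge0//.
rewrite exprMn !Hnorm_sqr// real_normK ?num_real//.
apply: quadratic_ge0_disc => [|t]; first exact: (si_ge0 siX).
have Xtg : X (t *: g) by exact: XZ.
have := si_ge0 siX (XD Xf Xtg).
rewrite (siDl siX) ?siDr ?(siZl siX) ?siZr//; last exact: XD.
by rewrite (siC siX Xg Xf)//; congr (_ <= _); ring.
Qed.

Lemma HnormD f g : X f -> X g -> Hnorm b (f + g) <= Hnorm b f + Hnorm b g.
Proof.
move=> Xf Xg.
rewrite -(@ler_pXn2r _ 2)// ?nnegrE ?addr_ge0 ?Hnorm_ge0//.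
rewrite sqrrD !Hnorm_sqr//; last exact: XD.
rewrite (siDl siX) ?siDr//; last exact: XD.
rewrite (siC siX Xg Xf)//.
have := le_trans (ler_norm _) (cauchy_schwarz_si Xf Xg).
rewrite mulr2n; lra.
Qed.

Lemma HnormN f : X f -> Hnorm b (- f) = Hnorm b f.
Proof.
move=> Xf; have XNf := siN Xf.
by rewrite /Hnorm siNl// (siC siX)// siNl// opprK.
Qed.

Lemma HnormB_le f g : X f -> X g -> Hnorm b (f - g) <= Hnorm b f + Hnorm b g.
Proof. by move=> Xf Xg; rewrite -(@HnormN g)//; apply: HnormD => //; exact: siN. Qed.

Lemma HnormB_triangle f g h : X f -> X g -> X h ->
  Hnorm b (f - g) <= Hnorm b (f - h) + Hnorm b (g - h).
Proof.
move=> Xf Xg Xh.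
have -> : f - g = (f - h) - (g - h) by rewrite opprB addrA subrK.
by apply: HnormB_le; exact: siB.
Qed.

Lemma Hnorm_cvg_si (S : Type) (F : set_system S) (u : S -> T -> R) h g :
  Filter F -> (forall n, X (u n)) -> X h -> X g ->
  (fun n => Hnorm b (u n - h)) @ F --> 0 -> (fun n => b (u n) g) @ F --> b h g.
Proof.
move=> FF Xu Xh Xg uh.
have c0 : (fun n => Hnorm b (u n - h) * Hnorm b g) @ F --> 0.
  by rewrite -(mul0r (Hnorm b g)); apply: cvgM => //; exact: cvg_cst.
apply: (@squeeze_cvgr _ _ _ _
  (fun n => b h g - Hnorm b (u n - h) * Hnorm b g)
  (fun n => b h g + Hnorm b (u n - h) * Hnorm b g)).
- apply: nearW => n; have := cauchy_schwarz_si (siB (Xu n) Xh) Xg.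
  by rewrite siBl// ler_distl.
- have cB := cvgB (cvg_cst (F := F) (b h g)) c0; rewrite subr0 in cB.
  exact: cB.
- have cD := cvgD (cvg_cst (F := F) (b h g)) c0; rewrite addr0 in cD.
  exact: cD.
Qed.

(* The minimizing sequence of [b f f - 2 L f] is Cauchy by the parallelogram
   identity, and its limit represents [L]. *)
Lemma riesz (L : (T -> R) -> R) (M : R) : si_complete X b ->
  (forall f g, X f -> X g -> L (f + g) = L f + L g) ->
  (forall a f, X f -> L (a *: f) = a * L f) ->
  (forall f, X f -> `|L f| <= M * Hnorm b f) ->
  exists2 h, X h & forall f, X f -> L f = b f h.
Proof.
move=> cX LD LZ LM; pose J f := b f f - 2 * L f.
pose m := inf [set J f | f in X].
have hi : has_inf [set J f | f in X].
  split; first by exists (J 0), 0.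
  (* Completing the square: [x ^+ 2 - 2 * M * x >= - M ^+ 2] with [x] the norm of [f]. *)
  exists (- M ^+ 2) => _ [f Xf <-]; rewrite /J -Hnorm_sqr//.
  have := le_trans (ler_norm _) (LM f Xf).
  have := sqr_ge0 (Hnorm b f - M); rewrite sqrrB mulr2n; lra.
have mJ f : X f -> m <= J f by move=> Xf; apply: ge_inf; [exact: hi.2|exists f].
have /choice[u uP] (n : nat) : exists f, X f /\ J f < m + n.+1%:R^-1.
  have n0 : 0 < n.+1%:R^-1 :> R by rewrite invr_gt0.
  have [_ [f Xf <-] Jf] := inf_adherent n0 hi.
  by exists f.
have Xu n : X (u n) := (uP n).1.
have small : forall e : R, 0 < e -> exists N, forall n, (N <= n)%N -> n.+1%:R^-1 < e.
  apply/(@cvg0_seqP R (fun n => n.+1%:R^-1)); last exact: cvg_harmonic.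
  by move=> n; rewrite invr_ge0.
have [] := cX u Xu.
  (* Comparing [J] at [u i], [u j] and their midpoint bounds the squared distance by twice the sum
     of the two excesses over [m], hence by four times this threshold. *)
  move=> e e0; have e4 : 0 < e ^+ 2 / 4 by rewrite divr_gt0 ?exprn_gt0.
  have [N Nh] := small _ e4.
  exists N => i j Ni Nj.
  rewrite -(@ltr_pXn2r _ 2)// ?nnegrE ?Hnorm_ge0 ?ltW//.
  have Xi := Xu i; have Xj := Xu j.
  have Xij : X (u i + u j) by exact: XD.
  rewrite Hnorm_sqr; last exact: siB.
  rewrite siBl//; last exact: siB.
  rewrite !siBr//.
  have := mJ (2^-1 *: (u i + u j)) (XZ _ Xij).
  rewrite /J LZ// LD// (siZl siX)//; last exact: XZ.
  rewrite siZr// (siDl siX)// !siDr//.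
  have := (uP i).2; have := (uP j).2; rewrite /J.
  rewrite (siC siX Xj Xi).
  have := Nh _ Ni; have := Nh _ Nj.
  by move: (i.+1%:R^-1) (j.+1%:R^-1) => p q; lra.
move=> h [Xh uh]; exists h => // g Xg.
have bgu : (fun n => b (u n) g) @ \oo --> b h g.
  exact: Hnorm_cvg_si.
(* First variation at the minimizer: [J (u n + t *: g) >= m > J (u n) - n.+1%:R^-1], then [n] tends
   to infinity. The zero constant term makes the discriminant bound force [b h g = L g]. *)
have key t : 0 <= 0 + 2 * t * (b h g - L g) + t ^+ 2 * b g g.
  have cv : (fun n => n.+1%:R^-1 + 2 * t * (b (u n) g - L g) + t ^+ 2 * b g g) @ \oo
     --> 0 + 2 * t * (b h g - L g) + t ^+ 2 * b g g.
    apply: cvgD; last exact: cvg_cst.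
    apply: cvgD; first exact: cvg_harmonic.
    apply: cvgM; first exact: cvg_cst.
    apply: cvgB => //; exact: cvg_cst.
  rewrite -(cvg_lim _ cv)//; apply: limr_ge; first by apply/cvg_ex; eexists; exact: cv.
  apply: nearW => n.
  have Xtg : X (t *: g) by exact: XZ.
  have := mJ (u n + t *: g) (XD (Xu n) Xtg).
  rewrite /J LD// LZ// (siDl siX) ?siDr ?(siZl siX) ?siZr//; last exact: XD.
  rewrite (siC siX Xg (Xu n))//.
  have := (uP n).2; rewrite /J; move: (n.+1%:R^-1) => p; lra.
have := quadratic_ge0_disc (si_ge0 siX Xg) key.
rewrite mul0r => c0; have /eqP : (b h g - L g) ^+ 2 = 0.
  by apply/eqP; rewrite eq_le c0 sqr_ge0.
by rewrite sqrf_eq0 subr_eq0 (siC siX)// => /eqP.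
Qed.
End SemiInnerProduct.

(** * Weak limits and weak sequential compactness *)

Section WeakLimits.
Context {R : realType} {T : Type}.
Context {X : set (T -> R)} {b : (T -> R) -> (T -> R) -> R}.
Context (siX : semi_inner X b) (cX : si_complete X b).

(** Each bounded scalar sequence [b (u n) h] converges along [F]; the limits form a linear
    functional of [h] bounded by [M], which Riesz represents. *)
Lemma weak_ultra_lim (F : set_system nat) (u : nat -> T -> R) (M : R) :
  UltraFilter F -> (forall n, X (u n)) -> (forall n, Hnorm b (u n) <= M) ->
  exists2 v, X v & forall h, X h -> (fun n => b (u n) h) @ F --> b v h.
Proof.
move=> FU Xu uM.
have /choice[L LP] (h : T -> R) : exists l : R, X h ->
    (fun n => b (u n) h) @ F --> l /\ `|l| <= M * Hnorm b h.
  have [Xh|nXh] := pselect (X h); last by exists 0.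
  have [n|l] := @bounded_ultra_cvg R _ F (fun n => b (u n) h) (M * Hnorm b h) FU.
    rewrite (le_trans (cauchy_schwarz_si siX (Xu n) Xh))//.
    by rewrite ler_wpM2r ?Hnorm_ge0.
  by exists l.
have FL h : X h -> (fun n => b (u n) h) @ F --> L h by move=> /LP[].
have [f g Xf Xg|a f Xf|f /LP[]//|v Xv Lv] := riesz (L := L) (M := M) siX cX.
- have XDfg := siD siX Xf Xg.
  apply: (cvg_unique _ (FL _ XDfg)) => //.
  rewrite (_ : (fun n => _) = (fun n => b (u n) f) \+ (fun n => b (u n) g)).
    by apply: cvgD; exact: FL.
  by apply/funext => n /=; rewrite (siDr siX).
- have XZf := siZ siX a Xf.
  apply: (cvg_unique _ (FL _ XZf)) => //.
  rewrite (_ : (fun n => _) = (fun n => a * b (u n) f)).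
    by apply: cvgM; [exact: cvg_cst|exact: FL].
  by apply/funext => n /=; rewrite (siZr siX).
exists v => // h Xh; rewrite (siC siX Xv Xh) -Lv//; exact: FL.
Qed.

(* A bounded sequence of pairwise asymptotically orthogonal vectors tends weakly
   to [0]: its weak limit along any ultrafilter is orthogonal to all its terms,
   hence to itself. *)
Lemma asymptotically_orthogonal_cvg0 (w : nat -> T -> R) (M : R) :
  (forall n, X (w n)) -> (forall n, Hnorm b (w n) <= M) ->
  (forall i, (fun n => b (w n) (w i)) @ \oo --> 0) ->
  forall h, X h -> (fun n => b (w n) h) @ \oo --> 0.
Proof.
move=> Xw wM w0 h Xh; apply: ultra_cvgP => F FU ooF.
have [v Xv wv] := weak_ultra_lim FU Xw wM.
have v0 i : b v (w i) = 0.
  apply: (cvg_unique _ (wv _ (Xw i))) => //.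
  by apply: cvg_trans (w0 i); exact: cvg_app.
have vv : b v v = 0.
  apply: (cvg_unique _ (wv _ Xv)) => //.
  rewrite (_ : (fun n => _) = cst 0); first exact: cvg_cst.
  by apply/funext => n /=; rewrite (siC siX (Xw n) Xv).
suff -> : 0 = b v h by exact: wv.
apply/esym/normr0_eq0/eqP; rewrite eq_le normr_ge0 andbT.
by rewrite (le_trans (cauchy_schwarz_si siX Xv Xh))// {1}/Hnorm vv sqrtr0 mul0r.
Qed.

(** A diagonal choice turns the ultrafilter limit [v] into a subsequence: the [j]-th chosen
    difference [u n - v] is almost orthogonal to [v] and to the first [j] terms of [u], which makes
    the differences asymptotically orthogonal. *)
Lemma weak_sequential_compactness (u : nat -> T -> R) (M : R) :
  (forall n, X (u n)) -> (forall n, Hnorm b (u n) <= M) ->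
  exists phi : nat -> nat, (forall n, (phi n < phi n.+1)%N) /\
  exists2 v, X v & forall h, X h -> (fun n => b (u (phi n) - v) h) @ \oo --> 0.
Proof.
move=> Xu uM.
have [F [FU ooF]] : exists F, UltraFilter F /\ \oo `<=` F.
  exact: ultraFilterLemma.
have [v Xv uv] := weak_ultra_lim FU Xu uM.
(* The test vectors are [v] followed by all terms of [u], so that [u (phi i) - v] is a difference of
   two of them. *)
pose t m := if m is m'.+1 then u m' else v.
have Xt m : X (t m) by case: m.
have [|phi [phi_inc phiP]] := @increasing_selection
    (fun j n => forall m, (m <= j)%N -> `|b (u n - v) (t m)| < j.+1%:R^-1).
  move=> j N.
  suff /filter_ex[n [Nn nP]] : F ([set n | (N < n)%N] `&`
     [set n | forall m, (m <= j)%N -> `|b (u n - v) (t m)| < j.+1%:R^-1]).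
    by exists n.
  apply: filterI; first exact: oo_ultra_gt.
  have Fm m : \forall n \near F, `|b (u n - v) (t m)| < j.+1%:R^-1.
    have /cvgrPdist_lt/(_ j.+1%:R^-1) := uv _ (Xt m).
    rewrite invr_gt0 ltr0n => /(_ isT); apply: filterS => n.
    by rewrite distrC (siBl siX).
  suff : forall k, F [set n | forall m, (m < k)%N -> `|b (u n - v) (t m)| < j.+1%:R^-1].
    by move=> /(_ j.+1).
  elim=> [|k IH]; first by apply: filterE.
  apply: filterS2 IH (Fm k) => n IHn kn m.
  by rewrite ltnS leq_eqVlt => /predU1P[->//|]; exact: IHn.
exists phi; split => //; exists v => //.
have Xw n : X (u (phi n) - v) by exact: (siB siX).
have wt m : (fun n => b (u (phi n) - v) (t m)) @ \oo --> 0.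
  apply/cvgr0Pnorm_lt => e e0.
  have /cvgr0Pnorm_lt/(_ e e0)[N _ Nh] := @cvg_harmonic R.
  (* The choice at stage [n] controls [t m] only for [m <= n]. *)
  exists (maxn N m) => // n /=; rewrite geq_max => /andP[Nn mn].
  apply: lt_trans (phiP _ _ mn) _.
  by have := Nh n Nn; rewrite /= ger0_norm// invr_ge0.
apply: (@asymptotically_orthogonal_cvg0 (fun n => u (phi n) - v) (M + Hnorm b v)).
- exact: Xw.
- by move=> n; rewrite (le_trans (HnormB_le siX (Xu _) Xv))// lerD2r uM.
- move=> i.
  rewrite (_ : (fun n => _) = (fun n => b (u (phi n) - v) (t (phi i).+1)) \-
    (fun n => b (u (phi n) - v) (t 0%N))).
    by rewrite -(subr0 (0 : R)); apply: cvgB; exact: wt.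
  by apply/funext => n /=; rewrite (siBr siX).
Qed.

End WeakLimits.

(** * The embedding, its adjoint and their compactness *)

Section EmbeddingOperator.
Context {R : realType} {T : Type}.
Context {X : set (T -> R)} {ip : (T -> R) -> (T -> R) -> R}.
Context (siX : semi_inner X ip) (cX : si_complete X ip).
Context {k : T -> T -> R} (Xk : forall s, X (k s)).
Context (kP : forall f s, X f -> f s = ip f (k s)).
Context {Y : set (T -> R)} {l : (T -> R) -> (T -> R) -> R}.
Context (siY : semi_inner Y l) (XY : forall f, X f -> Y f).
Context {C : R} (C0 : 0 <= C).
Context (SC : forall f, X f -> Hnorm l f <= C * Hnorm ip f).

(** This is [int_op mu k] when [l] is the L2 product. *)
Let A (g : T -> R) : T -> R := fun s => l (k s) g.

Lemma embedding_adjoint g : Y g -> X (A g) /\ forall f, X f -> ip f (A g) = l f g.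
Proof.
move=> Yg.
have [| |f Xf|h Xh lh] := @riesz _ _ _ _ siX (fun f => l f g) (C * Hnorm l g) cX.
- by move=> f1 f2 X1 X2; rewrite (siDl siY)//; exact: XY.
- by move=> a f Xf; rewrite (siZl siY)//; exact: XY.
- rewrite (le_trans (cauchy_schwarz_si siY (XY Xf) Yg))//.
  by rewrite mulrAC ler_wpM2r ?Hnorm_ge0 ?SC.
suff -> : A g = h by split=> // f Xf; rewrite lh.
by apply/funext => s; rewrite /A lh// kP// (siC siX Xh).
Qed.

Let XA g : Y g -> X (A g). Proof. by move=> /embedding_adjoint[]. Qed.
Let adjA f g : X f -> Y g -> ip f (A g) = l f g.
Proof. by move=> Xf /embedding_adjoint[_]; exact. Qed.

Let AB f g : Y f -> Y g -> A (f - g) = A f - A g.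
Proof.
move=> Yf Yg; apply/funext => s; rewrite /A (siBr siY)//; exact: XY.
Qed.

(** An adjoint inherits the operator bound: the square of the left norm is [l (A g) g], and one
    factor is cancelled unless it is 0. *)
Lemma adjoint_bound g : Y g -> Hnorm ip (A g) <= C * Hnorm l g.
Proof.
move=> Yg; have XAg := XA Yg.
have : Hnorm ip (A g) * Hnorm ip (A g) <= C * Hnorm l g * Hnorm ip (A g).
  rewrite -expr2 (Hnorm_sqr siX)// adjA// (le_trans (ler_norm _))//.
  rewrite (le_trans (cauchy_schwarz_si siY (XY XAg) Yg))//.
  by rewrite mulrAC ler_wpM2r ?Hnorm_ge0 ?SC.
have := Hnorm_ge0 (b := ip) (A g).
rewrite le_eqVlt => /predU1P[<- _|n0]; last by rewrite ler_pM2r.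
by rewrite mulr_ge0 ?Hnorm_ge0.
Qed.

Let cvg0_le (a c : nat -> R) (K : R) : (forall n, 0 <= a n) ->
  (forall n, a n <= K * c n) -> c @ \oo --> 0 -> a @ \oo --> 0.
Proof.
move=> a0 ac c0; apply: (@squeeze_cvgr _ _ _ _ (cst 0) (fun n => K * c n)).
- by apply: nearW => n; rewrite a0 ac.
- exact: cvg_cst.
- by rewrite -(mulr0 K); apply: cvgM => //; exact: cvg_cst.
Qed.

(* With [v] a weak limit of [u] along an ultrafilter, [l (u n - v) (u n - v)] is
   the limit in [m] of [l (u n - v) (u n - u m)], so that no completeness of [Y]
   is needed. *)
Lemma embedding_cauchy_cvg (u : nat -> T -> R) (M : R) :
  (forall n, X (u n)) -> (forall n, Hnorm ip (u n) <= M) ->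
  (forall e, 0 < e -> exists N, forall m n, (N <= m)%N -> (N <= n)%N ->
     Hnorm l (u m - u n) < e) ->
  exists2 v, X v & (fun n => Hnorm l (u n - v)) @ \oo --> 0.
Proof.
move=> Xu uM uC.
have [F [FU ooF]] : exists F, UltraFilter F /\ \oo `<=` F.
  exact: ultraFilterLemma.
have [v Xv uv] := weak_ultra_lim siX cX FU Xu uM.
exists v => //; apply/cvg0_seqP => [n|e e0]; first exact: Hnorm_ge0.
(* Limits keep only weak inequalities; the half restores the strict one. *)
have [N Nh] := uC (e / 2) ltac:(by rewrite divr_gt0).
exists N => n Nn; set d := u n - v.
have Xd : X d by exact: (siB siX).
have Yd := XY Xd; have Yn := XY (Xu n); have Yv := XY Xv.
have cv : (fun m => l (u n - u m) d) @ F --> l d d.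
  (* The adjoint rewrites [l v d] as [ip v (A d)], where the weak convergence in [X] applies. *)
  rewrite {3}/d (siBl siY)// -(adjA Xv Yd).
  rewrite (_ : (fun m => _) = (fun m => l (u n) d - ip (u m) (A d))).
    by apply: cvgB; [exact: cvg_cst|exact: uv (XA Yd)].
  by apply/funext => m; rewrite (siBl siY) ?adjA//; exact: XY.
have ld : l d d <= e / 2 * Hnorm l d.
  rewrite -(cvg_lim _ cv)//; apply: limr_le; first by apply/cvg_ex; eexists; exact: cv.
  apply: filterS (oo_ultra_gt N _ ooF) => m Nm.
  have Ym := XY (Xu m).
  rewrite (le_trans (ler_norm _))//.
  rewrite (le_trans (cauchy_schwarz_si siY (siB siY Yn Ym) Yd))//.
  by rewrite ler_wpM2r ?Hnorm_ge0// ltW// Nh// ltnW.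
have := ld; rewrite -(Hnorm_sqr siY)//.
have := Hnorm_ge0 (b := l) d; nra.
Qed.

Let S_compact := compact_operator X (Hnorm ip) Y (Hnorm l) id.
Let THH_compact := compact_operator X (Hnorm ip) X (Hnorm ip) A.
Let THL_compact := compact_operator X (Hnorm ip) Y (Hnorm l) A.
Let TLL_compact := compact_operator Y (Hnorm l) Y (Hnorm l) A.

(** [A] sends bounded sequences of [Y] to bounded sequences of [X], on which the compact embedding
    acts. *)
Lemma compact_embedding_TLL : S_compact -> TLL_compact.
Proof.
move=> cS u Yu [M uM]; apply: (cS (A \o u)) => [n|]; first exact: XA.
exists (C * M) => n /=; rewrite (le_trans (adjoint_bound (Yu n)))//.
by rewrite ler_wpM2l.
Qed.

Lemma compact_TLL_THL : TLL_compact -> THL_compact.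
Proof.
move=> cT u Xu [M uM]; apply: cT => [n|]; first exact: XY.
by exists (C * M) => n; rewrite (le_trans (SC (Xu n)))// ler_wpM2l.
Qed.

Lemma compact_embedding_THH : S_compact -> THH_compact.
Proof.
move=> cS u Xu uM; have [phi [phi_inc [g [Yg ug]]]] := cS u Xu uM.
exists phi; split => //; exists (A g); split; first exact: XA.
apply: cvg0_le ug => n; first exact: Hnorm_ge0.
have Yn := XY (Xu (phi n)).
by have := adjoint_bound (siB siY Yn Yg); rewrite AB//; exact.
Qed.

Lemma compact_THH_THL : THH_compact -> THL_compact.
Proof.
move=> cT u Xu uM; have [phi [phi_inc [g [Xg ug]]]] := cT u Xu uM.
exists phi; split => //; exists g; split; first exact: XY.
apply: cvg0_le ug => n; first exact: Hnorm_ge0.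
by apply: SC; apply: (siB siX) => //; apply: XA; exact: XY.
Qed.

Lemma compact_THL_embedding : THL_compact -> S_compact.
Proof.
move=> cT u Xu [M uM]; have [phi [phi_inc [g [Yg ug]]]] := cT u Xu (ex_intro _ M uM).
exists phi; split => //.
have M0 : 0 <= M := le_trans (Hnorm_ge0 (b := ip) (u 0%N)) (uM 0%N).
have [||e e0|v Xv uv] := @embedding_cauchy_cvg (u \o phi) M.
- by move=> n; exact: Xu.
- by move=> n; exact: uM.
(* The bounds [ld] and [iAd] combine into [ld4], with constant [K - 1]; the added 1 keeps [K]
   positive for the division. *)
- pose K := 2 * M * (2 * M) * (C * (2 * M)) + 1.
  have K0 : 0 < K by rewrite ltr_pwDr// !mulr_ge0.
  (* The factor 2 pays for the triangle inequality through [g]. *)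
  have e4 : 0 < e ^+ 4 / (2 * K) by rewrite divr_gt0 ?exprn_gt0 ?mulr_gt0.
  move/cvg0_seqP : ug => /(_ (fun=> Hnorm_ge0 _))/(_ _ e4)[N Nh].
  exists N => m n Nm Nn /=; set d := u (phi m) - u (phi n).
  have Xd : X d by exact: (siB siX).
  have Yd := XY Xd; have XAd := XA Yd; have YAd := XY XAd.
  have d2M : Hnorm ip d <= 2 * M.
    by rewrite (le_trans (HnormB_le siX _ _))// mulr2n mulrDl mul1r lerD.
  have ld : Hnorm l d ^+ 2 <= 2 * M * Hnorm ip (A d).
    rewrite (Hnorm_sqr siY)// -adjA// (le_trans (ler_norm _))//.
    rewrite (le_trans (cauchy_schwarz_si siX Xd XAd))//.
    by rewrite ler_wpM2r ?Hnorm_ge0.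
  have iAd : Hnorm ip (A d) ^+ 2 <= C * (2 * M) * Hnorm l (A d).
    rewrite (Hnorm_sqr siX)// adjA// (le_trans (ler_norm _))//.
    rewrite (le_trans (cauchy_schwarz_si siY YAd Yd))// mulrC.
    by rewrite ler_wpM2r ?Hnorm_ge0// (le_trans (SC Xd))// ler_wpM2l.
  have lAd : Hnorm l (A d) < e ^+ 4 / K.
    have Ym := XY (Xu (phi m)); have Yn := XY (Xu (phi n)).
    rewrite AB//; have := Nh _ Nm; have := Nh _ Nn.
    have := HnormB_triangle siY (XY (XA Ym)) (XY (XA Yn)) Yg.
    have -> : e ^+ 4 / K = 2 * (e ^+ 4 / (2 * K)) by field; lra.
    lra.
  rewrite -(@ltr_pXn2r _ 4)// ?nnegrE ?Hnorm_ge0 ?ltW//.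
  have ld4 : Hnorm l d ^+ 4 <= (K - 1) * Hnorm l (A d).
    rewrite (exprM _ 2 2); apply: (@le_trans _ _ ((2 * M * Hnorm ip (A d)) ^+ 2)).
      by rewrite lerXn2r ?nnegrE ?exprn_ge0 ?mulr_ge0 ?Hnorm_ge0.
    rewrite exprMn /K addrK expr2 -mulrA (mulrA (2 * M) (2 * M)).
    by rewrite -[X in _ <= X]mulrA ler_wpM2l ?mulr_ge0.
  apply: le_lt_trans ld4 _.
  apply: (@le_lt_trans _ _ (K * Hnorm l (A d))).
    by rewrite ler_wpM2r ?Hnorm_ge0// lerBlDr lerDl.
  by rewrite mulrC -ltr_pdivlMr.
- by exists v; split; first exact: XY.
Qed.

Let cond3 := forall u : nat -> T -> R, (forall n, X (u n)) ->
  (exists M : R, forall n, Hnorm ip (u n) <= M) ->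
  (forall t, (fun n => u n t) @ \oo --> (0 : R)) ->
  (fun n => Hnorm l (A (u n))) @ \oo --> 0.

(** Subtracting the weak limit of a subsequence leaves a bounded sequence that tends to 0 weakly,
    hence pointwise when tested on the kernels [k t]. *)
Lemma null_sequences_compact_THL : cond3 -> THL_compact.
Proof.
move=> c3 u Xu [M uM].
have [phi [phi_inc [v Xv uv]]] := weak_sequential_compactness siX cX Xu uM.
exists phi; split => //; exists (A v); split; first exact/XY/XA/XY.
have Xw n : X (u (phi n) - v) by exact: (siB siX).
rewrite (_ : (fun n => _) = (fun n => Hnorm l (A (u (phi n) - v)))); last first.
  by apply/funext => n; rewrite AB//; exact: XY.
apply: c3 => // [|t].
  exists (M + Hnorm ip v) => n.
  by rewrite (le_trans (HnormB_le siX (Xu _) Xv))// lerD2r uM.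
rewrite (_ : (fun n => _) = (fun n => ip (u (phi n) - v) (k t))); first exact: uv.
by apply/funext => n; rewrite -kP.
Qed.

(** It suffices that [u] tends to 0 in the seminorm of [l]. Otherwise a subsequence stays at least
    [e] away from 0, while compactness gives it an [l]-limit point [g], whose seminorm is shown to
    vanish. *)
Lemma compact_embedding_null_sequences : S_compact -> cond3.
Proof.
move=> cS u Xu [M uM] u0.
apply: (@cvg0_le _ (fun n => Hnorm l (u n)) (C * C)) => [n|n|].
- exact: Hnorm_ge0.
- have Yn := XY (Xu n).
  by rewrite (le_trans (SC (XA Yn)))// -mulrA ler_wpM2l// adjoint_bound.
apply/cvg0_seqP => [n|e e0]; first exact: Hnorm_ge0.
apply: contrapT => nN.
have [|psi [psi_inc psiP]] := @increasing_selection (fun _ n => e <= Hnorm l (u n)).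
  move=> _ N; apply: contrapT => h; apply: nN; exists N.+1 => n Nn.
  by rewrite ltNge; apply/negP => en; apply: h; exists n.
have [|phi [phi_inc [g [Yg ug]]]] := cS (u \o psi) (fun n => Xu (psi n)).
  by exists M => n; exact: uM.
pose w n := u (psi (phi n)).
have Xw n : X (w n) by exact: Xu.
have Yw n : Y (w n) by exact: XY.
have [F [FU ooF]] : exists F, UltraFilter F /\ \oo `<=` F.
  exact: ultraFilterLemma.
have [v Xv wv] := weak_ultra_lim siX cX FU Xw (fun n => uM (psi (phi n))).
(* Tested on kernels, the weak limit is the pointwise limit of [u]. *)
have v0 : v = 0.
  apply/funext => s; rewrite kP//.
  apply: (cvg_unique _ (wv _ (Xk s))) => //.
  rewrite (_ : (fun n => _) = (fun n => w n s)); last by apply/funext => n; rewrite kP.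
  apply: (cvg_comp (fun n => psi (phi n)) (fun n => u n s) _ (u0 s)).
  move=> B [N _ NB]; apply: ooF; exists N => // n /= Nn; apply: NB => /=.
  rewrite (leq_trans Nn)// (leq_trans (increasing_geid phi_inc n))//.
  exact: increasing_geid.
(* Along [F], [l (w n) g = ip (w n) (A g)] tends both to [l g g] and to [ip v (A g) = 0]. *)
have gg : Hnorm l g = 0.
  rewrite /Hnorm (_ : l g g = 0) ?sqrtr0//.
  have XAg := XA Yg.
  have lwg : (fun n => l (w n) g) @ F --> l g g.
    apply: (Hnorm_cvg_si siY) => //; apply: cvg_trans ug; exact: cvg_app.
  apply: (cvg_unique _ lwg) => //.
  rewrite (_ : (fun n => _) = (fun n => ip (w n) (A g))).
    suff <- : ip v (A g) = 0 by exact: wv.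
    by rewrite v0 -(scale0r (A g)) (siZl siX)// mul0r.
  by apply/funext => n; rewrite adjA.
move/cvg0_seqP : ug => /(_ (fun=> Hnorm_ge0 _))/(_ _ e0)[N Nh].
have := Nh N (leqnn N) => /=; rewrite ltNge => /negP; apply.
apply: (le_trans (psiP (phi N))).
have := HnormD siY (siB siY (Yw N) Yg) Yg; rewrite subrK => /le_trans; apply.
by rewrite gg addr0.
Qed.

End EmbeddingOperator.

(** * The L2 semi-inner product and its norm *)

Section L2SemiInner.
Context {R : realType} {d : measure_display} {T : measurableType d}.
Context (mu : {measure set T -> \bar R}).

Definition L2ip (f g : T -> R) : R := Rintegral mu setT (fun t => f t * g t).

Lemma L2_Lfun (f : T -> R) : L2 mu f <-> f \in Lfun mu 2%:E.
Proof.
split=> [[mf lf]|/andP[]]; first by apply/andP; rewrite !inE.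
by rewrite !inE.
Qed.

Lemma L2_mul_integrable (f g : T -> R) : L2 mu f -> L2 mu g ->
  mu.-integrable setT (EFin \o (fun t => f t * g t)).
Proof.
move=> /L2_Lfun Lf /L2_Lfun Lg.
exact/Lfun1_integrable/(Lfun2_mul_Lfun1 Lf Lg).
Qed.

Lemma L2_semi_inner : semi_inner (L2 mu) L2ip.
Proof.
have le12 : (1 <= 2%:E :> \bar R)%E by rewrite lee_fin ler1n.
have L20 : L2 mu 0 by apply/L2_Lfun; exact: (Lfun_submod_closed mu le12).1.
have L2ZD a f g : L2 mu f -> L2 mu g -> L2 mu (a *: f + g).
  by move=> /L2_Lfun ? /L2_Lfun ?; apply/L2_Lfun; exact: (Lfun_submod_closed mu le12).2.
have L2Z a f : L2 mu f -> L2 mu (a *: f).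
  by move=> Lf; rewrite -[_ *: _]addr0; exact: L2ZD.
split=> //.
- by move=> f g Lf Lg; rewrite -[f]scale1r; exact: L2ZD.
- by move=> f g _ _; apply: eq_Rintegral => t _; rewrite mulrC.
- move=> f g h Lf Lg Lh; rewrite /L2ip -RintegralD//; try exact: L2_mul_integrable.
  by apply: eq_Rintegral => t _; rewrite -mulrDl.
- move=> a f g Lf Lg; rewrite /L2ip -RintegralZl//; last exact: L2_mul_integrable.
  by apply: eq_Rintegral => t _; rewrite mulrA.
- by move=> f _; apply: Rintegral_ge0 => t _; rewrite -expr2 sqr_ge0.
Qed.

Lemma L2norm_sqr (f : T -> R) : L2 mu f ->
  (\int[mu]_s ((f s) ^+ 2)%:E)%E = (L2norm mu f ^+ 2)%:E.
Proof.
move=> [mf lf]; have := @powR_Lnorm _ _ _ mu (EFin \o f) 2 ltac:(by []).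
have fN : 'N[mu]_(2%:E)[EFin \o f]%E \is a fin_num.
  by rewrite ge0_fin_numE// Lnorm_ge0.
rewrite -(fineK fN) poweR_EFin powR_mulrn ?fine_ge0 ?Lnorm_ge0// => ->.
by apply: eq_integral => s _ /=; rewrite powR_mulrn// real_normK ?num_real.
Qed.

Lemma L2norm_Hnorm (f : T -> R) : L2 mu f -> L2norm mu f = Hnorm L2ip f.
Proof.
move=> Lf; rewrite /Hnorm /L2ip /Rintegral.
under eq_integral do rewrite -expr2.
rewrite L2norm_sqr//= sqrtr_sqr ger0_norm// fine_ge0//; exact: Lnorm_ge0.
Qed.

End L2SemiInner.

(** Links the extended-real integrals of condition (3) with real L2 norms. *)
Lemma sqr_EFin_cvg0 (R : realType) (a : nat -> R) : (forall n, 0 <= a n) ->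
  (fun n => (a n ^+ 2)%:E) @ \oo --> 0%E <-> a @ \oo --> (0 : R).
Proof.
move=> a0; split=> [a2|a_0].
  have /cvg0_seqP h : (fun n => a n ^+ 2) @ \oo --> (0 : R).
    by apply: (@fine_cvg _ _ _ _ (fun n => (a n ^+ 2)%:E)); exact: a2.
  apply/cvg0_seqP => // e e0.
  have [N Nh] := h (fun=> sqr_ge0 _) _ (exprn_gt0 2 e0).
  by exists N => n /Nh; rewrite ltr_pXn2r// nnegrE// ltW.
apply: cvg_EFin; first exact: nearW.
rewrite -(mulr0 (0 : R)).
by under eq_fun do rewrite /= expr2; exact: cvgM.
Qed.

(** Serves to exchange [L2norm mu] for [Hnorm (L2ip mu)], whose equality is established on [L2 mu]
    only. *)
Lemma eq_compact_operator (R : realType) (T1 T2 : Type)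
    (X : set (T1 -> R)) (nX nX' : (T1 -> R) -> R)
    (Y : set (T2 -> R)) (nY nY' : (T2 -> R) -> R) (A : (T1 -> R) -> T2 -> R) :
  (forall f, X f -> nX f = nX' f) ->
  (forall f g, X f -> Y g -> nY (A f \- g) = nY' (A f \- g)) ->
  compact_operator X nX Y nY A <-> compact_operator X nX' Y nY' A.
Proof.
move=> eX eY; split => cA u Xu [M uM].
- have [|phi [? [g [Yg ug]]]] := cA u Xu; first by exists M => n; rewrite eX.
  exists phi; split => //; exists g; split => //.
  by under eq_fun do rewrite -eY//.
- have [|phi [? [g [Yg ug]]]] := cA u Xu; first by exists M => n; rewrite -eX.
  exists phi; split => //; exists g; split => //.
  by under eq_fun do rewrite eY//.
Qed.

(** * The equivalences for the integral operators *)

Theorem theorem1 (R : realType) (d : measure_display) (T : measurableType d)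
    (k : T -> T -> R) (H : set (T -> R)) (ip : (T -> R) -> (T -> R) -> R)
    (mu : {measure set T -> \bar R}) :
  [set: T] !=set0 ->
  is_RKHS k H ip ->
  sigma_finite setT mu ->
  (forall f, H f -> L2 mu f) ->
  (exists C : R, forall f, H f -> L2norm mu f <= C * Hnorm ip f) ->
  let S_compact := compact_operator H (Hnorm ip) (L2 mu) (L2norm mu) id in
  let THH_compact := compact_operator H (Hnorm ip) H (Hnorm ip) (int_op mu k) in
  let THL_compact := compact_operator H (Hnorm ip) (L2 mu) (L2norm mu) (int_op mu k) in
  let TLL_compact := compact_operator (L2 mu) (L2norm mu) (L2 mu) (L2norm mu) (int_op mu k) in
  let cond3 := forall u : nat -> T -> R, (forall n, H (u n)) ->
      (exists M : R, forall n, Hnorm ip (u n) <= M) ->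
      (forall t, (fun n => u n t) @ \oo --> (0 : R)) ->
      (fun n => (\int[mu]_s ((int_op mu k (u n) s) ^+ 2)%:E)%E) @ \oo --> 0%E in
  [/\ S_compact <-> THH_compact /\ THL_compact /\ TLL_compact,
      S_compact <-> THH_compact \/ THL_compact \/ TLL_compact &
      S_compact <-> cond3].
Proof.
move=> _ [[[H0 HD HZ] [ipC ipDl ipZl ip_ge0 _] cH] Hk kP] _ HL [C' SC'].
have siH : semi_inner H ip by split.
have siL := L2_semi_inner mu.
(* The given bound [C'] carries no sign, and the operator estimates multiply by it. *)
pose C := Num.max C' 0.
have C0 : 0 <= C by rewrite le_max lexx orbT.
have SC f : H f -> Hnorm (L2ip mu) f <= C * Hnorm ip f.
  move=> Hf; rewrite -L2norm_Hnorm; last exact: HL.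
  by rewrite (le_trans (SC' f Hf))// ler_wpM2r ?Hnorm_ge0// le_max lexx.
have TH f : L2 mu f -> H (int_op mu k f).
  by move=> Lf; have [] := embedding_adjoint siH cH Hk kP siL HL SC Lf.
have TL f : L2 mu f -> L2 mu (int_op mu k f) by move=> /TH/HL.
have LB f g : L2 mu f -> L2 mu g ->
    L2norm mu (f \- g) = Hnorm (L2ip mu) (f \- g).
  by move=> Lf Lg; apply: L2norm_Hnorm; exact: (siB siL).
move=> S_compact THH_compact THL_compact TLL_compact cond3.
pose S' := compact_operator H (Hnorm ip) (L2 mu) (Hnorm (L2ip mu)) id.
pose THL' := compact_operator H (Hnorm ip) (L2 mu) (Hnorm (L2ip mu)) (int_op mu k).
pose TLL' := compact_operator (L2 mu) (Hnorm (L2ip mu)) (L2 mu) (Hnorm (L2ip mu))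
  (int_op mu k).
have eS : S_compact <-> S'.
  by apply: eq_compact_operator => // f g /HL Hf Lg; exact: LB.
have eTHL : THL_compact <-> THL'.
  by apply: eq_compact_operator => // f g /HL Hf Lg; apply: LB => //; exact: TL.
have eTLL : TLL_compact <-> TLL'.
  apply: eq_compact_operator => [f|f g Lf Lg]; first exact: L2norm_Hnorm.
  by apply: LB => //; exact: TL.
(* Two cycles share their last step: [S'], [TLL'], [THL'], [S'] and [S'], [THH_compact], [THL'],
   [S']. They settle both the conjunction and the disjunction. *)
have STLL : S' -> TLL' := compact_embedding_TLL siH cH Hk kP siL HL C0 SC.
have TLLTHL : TLL' -> THL' := compact_TLL_THL HL C0 SC.
have STHH : S' -> THH_compact := compact_embedding_THH siH cH Hk kP siL HL C0 SC.
have THHTHL : THH_compact -> THL' := compact_THH_THL siH cH Hk kP siL HL SC.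
have THLS : THL' -> S' := compact_THL_embedding siH cH Hk kP siL HL C0 SC.
have c3E : cond3 <-> forall u : nat -> T -> R, (forall n, H (u n)) ->
  (exists M : R, forall n, Hnorm ip (u n) <= M) ->
  (forall t, (fun n => u n t) @ \oo --> (0 : R)) ->
  (fun n => Hnorm (L2ip mu) (int_op mu k (u n))) @ \oo --> 0.
  have eI u : (forall n, H (u n)) ->
      (fun n => (\int[mu]_s ((int_op mu k (u n) s) ^+ 2)%:E)%E) =
      (fun n => (Hnorm (L2ip mu) (int_op mu k (u n)) ^+ 2)%:E).
    move=> Hu; apply/funext => n.
    have Ln := TL _ (HL _ (Hu n)); rewrite L2norm_sqr// L2norm_Hnorm//.
  split=> c3 u Hu uM u0; have := c3 u Hu uM u0.
    by rewrite eI// => /sqr_EFin_cvg0; apply=> n; exact: Hnorm_ge0.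
  by rewrite eI// => c; apply/sqr_EFin_cvg0 => // n; exact: Hnorm_ge0.
have S3 : S' <-> cond3.
  rewrite c3E; split=> [cS|c3].
    exact (compact_embedding_null_sequences siH cH Hk kP siL HL C0 SC cS).
  exact (THLS (null_sequences_compact_THL siH cH Hk kP siL HL SC c3)).
by split; tauto.
Qed.
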